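(* Let $0<r<2$ and let $(X,Y)$ be a real random vector with $\mathbb{E}|X|^{r}<\infty$ whose joint distribution is of one of the following two types. (a) Discrete case: there are an index set $I$, equal to $\{1,\ldots,n\}$ for some positive integer $n$ or to $\mathbb{N}$, pairwise distinct real numbers $(a_i)_{i\in I}$, and positive real numbers $(c_i)_{i\in I}$, $(d_i)_{i\in I}$ such that $\sum_{i\in I}\sum_{j\in I}\frac{d_id_j}{c_i+c_j}=1$ and $$\mathbb{P}(X=a_i,Y=a_j)=\frac{d_id_j}{c_i+c_j},\qquad i,j\in I.$$ (b) Continuous case: there are a Borel set $D\subseteq\mathbb{R}$ and measurable functions $c,d:D\to(0,\infty)$ such that $$f(x,y)=\frac{d(x)d(y)}{c(x)+c(y)},\qquad (x,y)\in D^2,$$ satisfies $\iint_{D^2}f(x,y)\,\mathrm{d}x\,\mathrm{d}y=1$, and $(X,Y)$ has joint density $f$ on $D^2$ (with respect to Lebesgue measure). Then $$\mathbb{E}|X+Y|^{r}\ \ge\ \mathbb{E}|X-Y|^{r}.$$ *)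

(* Defs.v *)
From HB Require Import structures.
From mathcomp Require Export all_boot all_order all_algebra.
From mathcomp Require Export all_classical all_reals all_analysis.

Set Implicit Arguments.
Unset Strict Implicit.
Unset Printing Implicit Defensive.

Export Order.TTheory GRing.Theory Num.Theory.
Export numFieldNormedType.Exports.

Local Open Scope classical_set_scope.
Local Open Scope ring_scope.
Local Open Scope ereal_scope.

Definition mass_kernel (R : realType) (U : Type) (c d : U -> R) (x y : U) : R :=
  (d x * d y / (c x + c y))%R.

(* The families are total functions on [nat], used only on the index set [I].
   Summands are positive on [I], so [\esum] is the usual (unconditional) sum. *)
Definition discrete_law (dT : measure_display) (T : measurableType dT)
    (R : realType) (P : probability T R) (X Y : {RV P >-> R}) : Prop :=
  exists (I : set nat) (a c d : nat -> R),
    [/\ (exists2 n : nat, (0 < n)%N & I = [set i | (1 <= i <= n)%N]) \/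
          I = [set: nat],
        {in I &, injective a},
        (forall i, I i -> (0 < c i)%R /\ (0 < d i)%R),
        \esum_(i in I) \esum_(j in I) (mass_kernel c d i j)%:E = 1 &
        forall i j, I i -> I j ->
          P [set w | X w = a i /\ Y w = a j] = (mass_kernel c d i j)%:E].

(* [c] and [d] are total functions on [R], used only on [D]; [measurable] on
   [R] and [R * R] refers to Borel sets.  The density is extended by 0 outside
   [D `*` D], whence the domain of the last integral. *)
Definition continuous_law (dT : measure_display) (T : measurableType dT)
    (R : realType) (P : probability T R) (X Y : {RV P >-> R}) : Prop :=
  exists (D : set R) (c d : R -> R),
    [/\ measurable D,
        measurable_fun D c /\ measurable_fun D d,
        (forall x, D x -> (0 < c x)%R /\ (0 < d x)%R),
        \int[lebesgue_measure \x lebesgue_measure]_(z in D `*` D)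
          (mass_kernel c d z.1 z.2)%:E = 1 &
        forall B : set (R * R), measurable B ->
          P [set w | B (X w, Y w)] =
          \int[lebesgue_measure \x lebesgue_measure]_(z in B `&` (D `*` D))
            (mass_kernel c d z.1 z.2)%:E].

(* Main.v *)
From HB Require Import structures.
Require Import Defs.
From mathcomp Require Import measurable_realfun lra ring.

(** Two facts combine.

    First, |u|^r is a mixture of functions 1 - cos (s u) with positive weights
    (0 < r < 2).  Writing s = exp v, the mixture is
      |u|^r * C = \int_v (1 - cos (e^v u)) e^(-rv) dv,
    because replacing u by 1 translates v by ln |u|, and Lebesgue measure is
    invariant under translation ([absr_powR_cos_integral]).  The constant C is
    finite because 1 - cos is bounded, which controls v > 0 since 0 < r, and is
    at most quadratic at 0, which controls v < 0 since r < 2; and C > 0.  So it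
    is enough to compare E (1 - cos (s (X - Y))) with E (1 - cos (s (X + Y)))
    for each s, and the second exceeds the first by 2 E (sin (s X) sin (s Y)).

    Secondly, E (g X * g Y) >= 0 for every bounded g when the law of (X, Y) has
    the weights d(x) d(y) / (c(x) + c(y)).  Indeed 1 / (c + c') is the integral
    of e^(-tc) e^(-tc') over t >= 0, so the law of (X, Y) is a mixture over t of
    product measures with equal factors, and each of them contributes the square
    of \int g(x) d(x) e^(-t c(x)) ([cauchy_form_laplace]).

    Convergence is never an issue: 1 - cos is nonnegative, and g is split into
    its positive and negative parts p and q, so that E (g X * g Y) >= 0 becomes
    E pq + E qp <= E pp + E qq, an inequality between integrals of nonnegative
    functions ([positive_definite_law]).  Every exchange of integrals is then an
    application of Tonelli's theorem.  The two types of law enter only through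
    the formula that expresses E (p X * q Y) as a double integral against the
    kernel, with counting measure in the discrete case and Lebesgue measure in
    the continuous one. *)

Set Implicit Arguments.
Unset Strict Implicit.
Unset Printing Implicit Defensive.

Local Open Scope classical_set_scope.
Local Open Scope ring_scope.
Local Open Scope ereal_scope.

(** * Powers of the absolute value as mixtures of 1 - cos *)

Section CosMixture.
Context {R : realType}.
Local Notation mu := (@lebesgue_measure R).

Lemma lebesgue_measure_translation (l : R) (A : set R) : measurable A ->
  pushforward mu ((fun v => v + l)%R : _ -> measurableTypeR R) A = mu A.
Proof.
move=> mA; apply/esym/lebesgue_measure_unique => //=.
  exact: measurable_funD.
move=> _ _ [[a b]] _ <-; rewrite /pushforward.
have -> : (fun v : R => v + l)%R @^-1` `]a, b] = `](a - l)%R, (b - l)%R]%classic.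
  by apply/seteqP; split => v; rewrite /= !in_itv/= ltrBlDr lerBrDr.
rewrite !lebesgue_measure_itv/= !lte_fin ltrD2r.
by case: ifPn => // _; rewrite -!EFinB; congr EFin; ring.
Qed.

Lemma ge0_integral_translation (l : R) (f : R -> \bar R) :
  measurable_fun [set: R] f -> (forall v, 0 <= f v) ->
  \int[mu]_v f (v + l)%R = \int[mu]_v f v.
Proof.
move=> mf f0.
transitivity (\int[pushforward mu
  ((fun v => v + l)%R : _ -> measurableTypeR R)]_v f v); last first.
  apply: eq_measure_integral => [|mD A mA _]; first exact: measurable_funD.
  exact: lebesgue_measure_translation.
rewrite ge0_integral_pushforward//=.
exact: measurable_funD.
Qed.

(** This turns the kernel 1 / (c + c') into a mixture of products, and bounds both
    tails of the constant in the representation of the r-th power. *)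
Lemma integral_expRN (c : R) : (0 < c)%R ->
  \int[mu]_(t in `[0%R, +oo[) (expR (- (t * c)))%:E = (c^-1)%:E.
Proof.
move=> c0; have := integral_exponential_pdf c0.
have -> : \int[mu]_x (exponential_pdf c x)%:E =
    \int[mu]_(t in `[0%R, +oo[) (c%:E * (expR (- (t * c)))%:E).
  rewrite [RHS]integral_mkcond; apply: eq_integral => t _.
  by rewrite /exponential_pdf !patchE; case: ifP => //; rewrite mulNr (mulrC t).
rewrite ge0_integralZl_EFin//=; last 2 first.
  by apply/measurable_EFinP; apply: measurable_funTS;
     apply: measurableT_comp => //; apply: measurableT_comp => //; exact: measurable_funM.
  exact: ltW.
move=> h.
have := congr1 (fun e => (c^-1)%:E * e) h.
by rewrite muleA -EFinM mulVf ?gt_eqF// mul1e mule1.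
Qed.

Lemma measurable_cos : measurable_fun [set: R] cos.
Proof. by apply: continuous_measurable_fun; exact: continuous_cos. Qed.

Lemma measurable_sin : measurable_fun [set: R] sin.
Proof. by apply: continuous_measurable_fun; exact: continuous_sin. Qed.

(** The substitution s = exp v turns (1 - cos s) s^(-1-r) ds into this function
    times dv. *)
Definition cos_profile (r v : R) : R := ((1 - cos (expR v)) * expR (- (r * v)))%R.

Lemma one_sub_cos_ge0 (x : R) : (0 <= 1 - cos x)%R.
Proof. by rewrite subr_ge0 cos_le1. Qed.

Lemma cos_profile_ge0 r v : (0 <= cos_profile r v)%R.
Proof. by rewrite mulr_ge0 ?expR_ge0 ?one_sub_cos_ge0. Qed.

Lemma measurable_cos_profile r : measurable_fun setT (cos_profile r).
Proof.
apply: measurable_funM; last first.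
  by apply: measurableT_comp => //; apply: measurableT_comp => //; exact: measurable_funM.
apply: measurable_funB => //; apply: measurableT_comp => //.
exact: measurable_cos.
Qed.

Definition levy_const (r : R) : \bar R := \int[mu]_v (cos_profile r v)%:E.

(** The change of variable is the translation v + ln |u|: it multiplies exp v by
    |u| and the weight exp (- r v) by |u| to the power - r. *)
Lemma absr_powR_cos_integral (r u : R) : (0 < r)%R ->
  \int[mu]_v ((1 - cos (expR v * u)) * expR (- (r * v)))%:E =
  (`|u| `^ r)%:E * levy_const r.
Proof.
move=> r0; have [->|u0] := eqVneq u 0%R.
  rewrite normr0 powR0 ?gt_eqF// mul0e integral0_eq// => v _.
  by rewrite mulr0 cos0 subrr mul0r.
have nu0 : (0 < `|u|)%R by rewrite normr_gt0.
rewrite /levy_const -[in RHS](ge0_integral_translation (ln `|u|)); last 2 first.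
  by apply/measurable_EFinP; exact: measurable_cos_profile.
  by move=> v; rewrite lee_fin cos_profile_ge0.
rewrite -ge0_integralZl_EFin//=; last 2 first.
  by move=> v; rewrite lee_fin cos_profile_ge0.
  apply/measurable_EFinP/measurableT_comp; first exact: measurable_cos_profile.
  exact: measurable_funD.
apply: eq_integral => v _; rewrite -EFinM; congr EFin.
rewrite /cos_profile expRD lnK ?posrE//.
have -> : cos (expR v * u) = cos (expR v * `|u|).
  by case: (ger0P u) => // _; rewrite mulrN cosN.
rewrite mulrCA; congr (_ * _)%R.
rewrite /powR (negbTE (lt0r_neq0 nu0)) -expRD; congr expR; ring.
Qed.

Lemma one_sub_cos_le (x : R) : (0 <= x)%R -> (1 - cos x <= x ^+ 2)%R.
Proof.
move=> x0; have [->|xn0] := eqVneq x 0%R; first by rewrite cos0 subrr expr2 mul0r.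
have y0 : (0 < x / 2)%R by rewrite divr_gt0// lt_neqAle eq_sym xn0.
(* the mean value theorem bounds sin (x / 2) ^ 2, and 1 - cos x = 2 sin (x / 2) ^ 2 *)
have [z _] : exists2 z, z \in `]0%R, (x / 2)%R[ &
    (sin (x / 2) - sin 0 = cos z * (x / 2 - 0))%R.
  apply: MVT => //.
  by apply/continuous_subspaceT => ?; exact: continuous_sin.
rewrite sin0 !subr0 => sE.
have s2 : (sin (x / 2) ^+ 2 <= (x / 2) ^+ 2)%R.
  by rewrite sE exprMn ler_piMl ?sqr_ge0// -sqr_normr exprn_ile1// cos_max.
have xE : x = (x / 2 + x / 2)%R by rewrite -splitr.
have -> : cos x = (cos (x / 2) ^+ 2 *+ 2 - 1)%R by rewrite -cos_mulr2n mulr2n -xE.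
have -> : (x ^+ 2 = 4 * (x / 2) ^+ 2)%R by field.
have := cos2Dsin2 (x / 2); have := sqr_ge0 (x / 2); move: s2.
by move: (_ ^+ 2)%R (_ ^+ 2)%R (_ ^+ 2)%R => A B C; rewrite mulr2n; lra.
Qed.

(** The integrand is at most 2 exp (- r v) for v >= 0 and, since 1 - cos is at
    most quadratic, at most exp ((2 - r) v) for v <= 0. *)
Lemma levy_const_lty (r : R) : (0 < r)%R -> (r < 2)%R -> levy_const r < +oo.
Proof.
move=> r0 r2.
have mE (k : R) : measurable_fun setT (fun v : R => expR (- (v * k))).
  by apply: measurableT_comp => //; apply: measurableT_comp => //; exact: measurable_funM.
rewrite /levy_const -(setUv `[0%R, +oo[%classic) ge0_integral_setU//=; last 4 first.
- exact: measurableC.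
- by rewrite setUv; apply/measurable_EFinP; exact: measurable_cos_profile.
- by move=> v _; rewrite lee_fin cos_profile_ge0.
- exact/disj_setPCl.
apply: lte_add_pinfty.
  apply: (@le_lt_trans _ _ (\int[mu]_(v in `[0%R, +oo[) (2 * expR (- (v * r)))%:E)).
    apply: ge0_le_integral => //.
    - by move=> v _; rewrite lee_fin cos_profile_ge0.
    - by apply/measurable_EFinP/measurable_funTS; exact: measurable_cos_profile.
    - by apply/measurable_EFinP/measurable_funTS; apply: measurable_funM => //; exact: mE.
    - move=> v _; rewrite lee_fin /cos_profile (mulrC r) ler_wpM2r ?expR_ge0//.
      by have := cos_geN1 (expR v); lra.
  under eq_integral do rewrite EFinM.
  rewrite ge0_integralZl_EFin//=; last first.
    by apply/measurable_EFinP/measurable_funTS; exact: mE.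
  by rewrite integral_expRN// -EFinM ltry.
rewrite setCitvr.
apply: (@le_lt_trans _ _ (\int[mu]_(v in `]-oo, 0%R]) (expR (v * (2 - r)))%:E)).
  apply: (@le_trans _ _ (\int[mu]_(v in `]-oo, 0%R]) (cos_profile r v)%:E)).
    apply: ge0_subset_integral => //.
    - by apply/measurable_EFinP/measurable_funTS; exact: measurable_cos_profile.
    - by move=> v _; rewrite lee_fin cos_profile_ge0.
    - by move=> v /=; rewrite !in_itv/=; exact: ltW.
  apply: ge0_le_integral => //.
  - by move=> v _; rewrite lee_fin cos_profile_ge0.
  - by apply/measurable_EFinP/measurable_funTS; exact: measurable_cos_profile.
  - apply/measurable_EFinP/measurable_funTS/measurableT_comp => //.
    exact: measurable_funM.
  - move=> v _; rewrite lee_fin /cos_profile.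
    rewrite (_ : v * (2 - r) = v *+ 2 + - (r * v))%R; last by ring.
    rewrite expRD ler_wpM2r ?expR_ge0// (le_trans (one_sub_cos_le (expR_ge0 _)))//.
    by rewrite -expRM_natl mulr_natl.
(* reflect the negative half-line onto the positive one *)
have h := @ge0_integration_by_substitution0 R (fun v => (expR (- (v * (2 - r))))%:E).
under eq_integral do rewrite -[X in expR X]opprK -mulNr.
rewrite -h; last 2 first.
  by apply/measurable_EFinP.
  by move=> v; rewrite lee_fin expR_ge0.
by rewrite integral_expRN ?ltry// subr_gt0.
Qed.

(** It is enough to look at pi / 2 <= exp v <= pi, where cos is nonpositive and
    the integrand is therefore at least exp (- r ln pi). *)
Lemma levy_const_gt0 (r : R) : (0 < r)%R -> 0 < levy_const r.
Proof.
move=> r0.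
have pi0 := @pi_gt0 R.
have lnlt : (ln (pi / 2) < ln pi :> R)%R by rewrite ltr_ln ?posrE; lra.
pose m : R := expR (- (r * ln pi)).
apply: (@lt_le_trans _ _ (\int[mu]_(v in `[ln (pi / 2), ln pi]) (cst m%:E v))).
  rewrite integral_cst//= lebesgue_measure_itv/= lte_fin lnlt -EFinB -EFinM.
  by rewrite lte_fin mulr_gt0 ?expR_gt0// subr_gt0.
apply: (@le_trans _ _ (\int[mu]_(v in `[ln (pi / 2), ln pi]) (cos_profile r v)%:E)).
  apply: ge0_le_integral => //.
  - by move=> v _; rewrite lee_fin expR_ge0.
  - by apply/measurable_EFinP/measurable_funTS; exact: measurable_cos_profile.
  - move=> v /=; rewrite in_itv/= => /andP[v1 v2]; rewrite lee_fin /cos_profile.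
    have e1 : (pi / 2 <= expR v)%R by rewrite -ler_ln ?posrE ?expR_gt0 ?expRK//; lra.
    have e2 : (expR v <= pi)%R by rewrite -(@lnK _ pi) ?posrE// ler_expR.
    have c0 : (cos (expR v) <= 0)%R.
      by rewrite -oppr_ge0 -sinBpihalf sin_ge0_pi//; apply/andP; split; lra.
    have : (m <= expR (- (r * v)))%R by rewrite ler_expR lerN2 ler_pM2l.
    have := expR_ge0 (- (r * v)); nra.
apply: ge0_subset_integral => //.
- by apply/measurable_EFinP; exact: measurable_cos_profile.
- by move=> v _; rewrite lee_fin cos_profile_ge0.
Qed.
End CosMixture.

(** * Positive definiteness of the Cauchy kernel *)

(** Infinite values are allowed because the Laplace transforms below may diverge. *)
Lemma mule_sym_le_sqr (R : realType) (a b : \bar R) : 0 <= a -> 0 <= b ->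
  a * b + b * a <= a * a + b * b.
Proof.
case: a => [a| |]; case: b => [b| |] //= a0 b0.
- rewrite -!EFinM -!EFinD lee_fin; have := sqr_ge0 (a - b)%R; rewrite expr2; nra.
- by rewrite mulyy addey ?leey// gt_eqF// (lt_le_trans _ (mule_ge0 _ _)).
- by rewrite mulyy addye ?leey// gt_eqF// (lt_le_trans _ (mule_ge0 _ _)).
Qed.

Lemma integral_sym_le_sqr (R : realType) d (T : measurableType d)
    (mu : {measure set T -> \bar R}) (A B : T -> \bar R) :
  measurable_fun setT A -> measurable_fun setT B ->
  (forall t, 0 <= A t) -> (forall t, 0 <= B t) ->
  \int[mu]_t (A t * B t) + \int[mu]_t (B t * A t) <=
  \int[mu]_t (A t * A t) + \int[mu]_t (B t * B t).
Proof.
move=> mA mB A0 B0.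
have mM (f g : T -> \bar R) : measurable_fun setT f -> measurable_fun setT g ->
    measurable_fun setT (fun t => f t * g t) by exact: emeasurable_funM.
rewrite -!ge0_integralD//; do ?[exact: mM | by move=> t _; exact: mule_ge0].
apply: ge0_le_integral => //.
- by move=> t _; rewrite adde_ge0// mule_ge0.
- by apply: emeasurable_funD; exact: mM.
- by apply: emeasurable_funD; exact: mM.
- by move=> t _; exact: mule_sym_le_sqr.
Qed.

Section Mixture.
Context {R : realType} dS (S : measurableType dS).
Variables (m : {sigma_finite_measure set S -> \bar R}) (c : S -> R).
Hypotheses (mc : measurable_fun setT c) (c_gt0 : forall x, (0 < c x)%R).
Local Notation mu := (@lebesgue_measure R).

(** Extending exp (- t c(x)) by 0 to t < 0 lets all the integrals in t run over
    the whole line. *)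
Definition exp_weight (x : S) (t : R) : R :=
  (\1_(`[0%R, +oo[%classic : set R) t * expR (- (t * c x)))%R.

Definition laplace (h : S -> R) (t : R) : \bar R :=
  \int[m]_x (h x * exp_weight x t)%:E.

Lemma exp_weight_ge0 x t : (0 <= exp_weight x t)%R.
Proof. by rewrite mulr_ge0 ?expR_ge0// indicE. Qed.

Lemma measurable_exp_weight :
  measurable_fun [set: S * R] (fun z => exp_weight z.1 z.2).
Proof.
apply: measurable_funM.
  exact: (measurableT_comp (measurable_indic _) measurable_snd).
apply: measurableT_comp => //; apply: measurableT_comp => //.
apply: measurable_funM; first exact: measurable_snd.
exact: measurableT_comp.
Qed.

Lemma integral_exp_weightM x y :
  \int[mu]_t (exp_weight x t * exp_weight y t)%:E = ((c x + c y)^-1)%:E.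
Proof.
rewrite -integral_expRN ?addr_gt0// [RHS]integral_mkcond.
apply: eq_integral => t _; rewrite patchE /exp_weight indicE.
case: ifP => _; last by rewrite !mul0r.
by rewrite !mul1r -expRD mulrDr opprD.
Qed.

Lemma measurable_mul_weight (h : S -> R) : measurable_fun setT h ->
  measurable_fun [set: S * R] (fun z => (h z.1 * exp_weight z.1 z.2)%:E).
Proof.
move=> mh; apply/measurable_EFinP/measurable_funM; last exact: measurable_exp_weight.
exact: measurableT_comp mh measurable_fst.
Qed.

Lemma laplace_ge0 (h : S -> R) t : (forall x, (0 <= h x)%R) -> 0 <= laplace h t.
Proof.
by move=> h0; apply: integral_ge0 => x _; rewrite lee_fin mulr_ge0 ?exp_weight_ge0.
Qed.

Lemma measurable_laplace (h : S -> R) : measurable_fun setT h -> (forall x, (0 <= h x)%R) ->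
  measurable_fun setT (laplace h).
Proof.
move=> mh h0.
apply: (measurable_fun_fubini_tonelli_G (fun z => (h z.1 * exp_weight z.1 z.2)%:E)).
  exact: measurable_mul_weight.
by move=> z; rewrite lee_fin mulr_ge0 ?exp_weight_ge0.
Qed.

(** The bilinear form of the Cauchy kernel is an inner product of Laplace
    transforms: expand the kernel as an integral over t, then move t outside by
    Tonelli, once past y and once past x. *)
Lemma cauchy_form_laplace (g h : S -> R) :
  measurable_fun setT g -> measurable_fun setT h ->
  (forall x, (0 <= g x)%R) -> (forall x, (0 <= h x)%R) ->
  \int[m]_x \int[m]_y (g x * h y / (c x + c y))%:E =
  \int[mu]_t (laplace g t * laplace h t).
Proof.
move=> mg mh g0 h0.
have gw0 x t : (0 <= g x * exp_weight x t)%R by rewrite mulr_ge0 ?exp_weight_ge0.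
have hw0 x t : (0 <= h x * exp_weight x t)%R by rewrite mulr_ge0 ?exp_weight_ge0.
have msec (f : S -> R) x : measurable_fun setT f ->
    measurable_fun [set: R] (fun t => (f x * exp_weight x t)%:E).
  move=> mf; apply/measurable_EFinP/measurable_funM => //.
  exact: (measurableT_comp measurable_exp_weight (measurable_pair1 x)).
have msec2 (f : S -> R) t : measurable_fun setT f ->
    measurable_fun [set: S] (fun x => (f x * exp_weight x t)%:E).
  move=> mf; apply/measurable_EFinP/measurable_funM => //.
  exact: (measurableT_comp measurable_exp_weight (measurable_pair2 t)).
transitivity (\int[m]_x \int[mu]_t ((g x * exp_weight x t)%:E * laplace h t)).
  apply: eq_integral => x _.
  transitivity (\int[m]_y \int[mu]_t
      ((g x * exp_weight x t)%:E * (h y * exp_weight y t)%:E)).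
    apply: eq_integral => y _; rewrite EFinM -integral_exp_weightM.
    rewrite -ge0_integralZl_EFin//.
    - by apply: eq_integral => t _; rewrite -!EFinM; congr EFin; ring.
    - by move=> t _; rewrite lee_fin mulr_ge0 ?exp_weight_ge0.
    - by apply/measurable_EFinP/measurable_funM;
        [exact: (measurableT_comp measurable_exp_weight (measurable_pair1 x))|
         exact: (measurableT_comp measurable_exp_weight (measurable_pair1 y))].
    - by rewrite mulr_ge0.
  rewrite (fubini_tonelli
    (fun z : S * measurableTypeR R =>
      (g x * exp_weight x z.2)%:E * (h z.1 * exp_weight z.1 z.2)%:E))/=.
  - apply: eq_integral => t _; rewrite ge0_integralZl_EFin//.
    by move=> y _; rewrite lee_fin.
    exact: msec2.
  - apply: emeasurable_funM; last exact: measurable_mul_weight.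
    exact: (measurableT_comp (msec g x mg) measurable_snd).
  - by move=> z; rewrite mule_ge0// lee_fin.
rewrite (fubini_tonelli
  (fun z : S * measurableTypeR R => (g z.1 * exp_weight z.1 z.2)%:E * laplace h z.2))/=.
- apply: eq_integral => t _; rewrite ge0_integralZr//; last exact: laplace_ge0.
  exact: msec2.
  by move=> y _; rewrite lee_fin.
- apply: emeasurable_funM; first exact: measurable_mul_weight.
  have mL : measurable_fun [set: measurableTypeR R] (laplace h).
    exact: measurable_laplace.
  exact: (measurableT_comp mL measurable_snd).
- by move=> z; rewrite mule_ge0 ?laplace_ge0// lee_fin.
Qed.

Lemma cauchy_form_psd (g h : S -> R) :
  measurable_fun setT g -> measurable_fun setT h ->
  (forall x, (0 <= g x)%R) -> (forall x, (0 <= h x)%R) ->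
  \int[m]_x \int[m]_y (g x * h y / (c x + c y))%:E +
  \int[m]_x \int[m]_y (h x * g y / (c x + c y))%:E <=
  \int[m]_x \int[m]_y (g x * g y / (c x + c y))%:E +
  \int[m]_x \int[m]_y (h x * h y / (c x + c y))%:E.
Proof.
move=> mg mh g0 h0.
rewrite (cauchy_form_laplace mg mh g0 h0) (cauchy_form_laplace mh mg h0 g0).
rewrite (cauchy_form_laplace mg mg g0 g0) (cauchy_form_laplace mh mh h0 h0).
by apply: integral_sym_le_sqr;
  [exact: measurable_laplace|exact: measurable_laplace|move=> t|move=> t];
  exact: laplace_ge0.
Qed.

End Mixture.

(** With g = p - q this says that the expectation of g(X) g(Y) is nonnegative.
    Keeping p and q apart makes all four integrals meaningful in [0, +oo] for
    unbounded p and q. *)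
Definition positive_definite_law dT (T : measurableType dT) (R : realType)
    (P : probability T R) (X Y : T -> R) : Prop :=
  forall p q : R -> R, measurable_fun setT p -> measurable_fun setT q ->
  (forall x, (0 <= p x)%R) -> (forall x, (0 <= q x)%R) ->
  \int[P]_w (p (X w) * q (Y w))%:E + \int[P]_w (q (X w) * p (Y w))%:E <=
  \int[P]_w (p (X w) * p (Y w))%:E + \int[P]_w (q (X w) * q (Y w))%:E.

(** Positive definiteness for a kernel that lives on D: extending c by 1 and
    d by 0 outside D reduces it to functions on the whole space. *)
Lemma positive_definite_law_cauchy dT (T : measurableType dT) (R : realType)
    (P : probability T R) (X Y : T -> R) dS (S : measurableType dS)
    (m : {sigma_finite_measure set S -> \bar R}) (D : set S) (a c d : S -> R) :
  measurable D -> measurable_fun setT a ->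
  measurable_fun D c -> measurable_fun D d ->
  (forall x, D x -> (0 < c x)%R /\ (0 < d x)%R) ->
  (forall p q : R -> R, measurable_fun setT p -> measurable_fun setT q ->
    (forall x, (0 <= p x)%R) -> (forall x, (0 <= q x)%R) ->
    \int[P]_w (p (X w) * q (Y w))%:E =
    \int[m]_(x in D) \int[m]_(y in D) (p (a x) * q (a y) * mass_kernel c d x y)%:E) ->
  positive_definite_law P X Y.
Proof.
move=> mD ma mc md cd0 E p q mp mq p0 q0.
pose c' x := (((fun x => c x - 1) \_ D) x + 1)%R.
have c'D x : x \in D -> c' x = c x by move=> xD; rewrite /c' patchE xD subrK.
have mc' : measurable_fun setT c'.
  apply: measurable_funD => //; apply/(measurable_restrictT _ mD).
  exact: measurable_funB.
have c'0 x : (0 < c' x)%R.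
  case: (boolP (x \in D)) => xD; first by rewrite c'D//; case: (cd0 x (set_mem xD)).
  by rewrite /c' patchE (negbTE xD) add0r.
pose h (f : R -> R) := ((fun x => f (a x) * d x) \_ D)%R.
have mh (f : R -> R) : measurable_fun setT f -> measurable_fun setT (h f).
  move=> mf; apply/(measurable_restrictT _ mD)/measurable_funM => //.
  by apply: measurable_funTS; exact: measurableT_comp.
have h0 (f : R -> R) x : (forall x, (0 <= f x)%R) -> (0 <= h f x)%R.
  move=> f0; rewrite /h patchE; case: ifPn => // /set_mem/cd0[_ d0].
  by rewrite mulr_ge0// ltW.
have EE (f g : R -> R) : measurable_fun setT f -> measurable_fun setT g ->
    (forall x, (0 <= f x)%R) -> (forall x, (0 <= g x)%R) ->
    \int[P]_w (f (X w) * g (Y w))%:E =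
    \int[m]_x \int[m]_y (h f x * h g y / (c' x + c' y))%:E.
  move=> mf mg f0 g0; rewrite E// integral_mkcond.
  apply: eq_integral => x _; rewrite patchE; case: ifPn => xD; last first.
    by rewrite integral0_eq// => y _; rewrite /h patchE (negbTE xD) !mul0r.
  rewrite integral_mkcond.
  apply: eq_integral => y _; rewrite patchE; case: ifPn => yD; last first.
    by rewrite /h !patchE (negbTE yD) mulr0 mul0r.
  by congr EFin; rewrite /h !patchE xD yD !c'D// /mass_kernel; ring.
rewrite !EE//; apply: cauchy_form_psd => //; do ?exact: mh; by move=> x; exact: h0.
Qed.

(** * Comparison of moments for positive definite laws *)

Section Moments.
Context {R : realType} dT (T : measurableType dT) (P : probability T R).
Local Notation mu := (@lebesgue_measure R).

Lemma measurable_one_sub_cos (f : T -> R) : measurable_fun setT f ->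
  measurable_fun setT (fun w => (1 - cos (f w))%R).
Proof.
move=> mf; apply: measurable_funB => //.
exact: measurableT_comp (@measurable_cos R) mf.
Qed.

(** With p and q the positive and negative parts of sin (s x),
    cos (s (x - y)) - cos (s (x + y)) = 2 (p(x) - q(x)) (p(y) - q(y)).
    Moving the negative terms to the other side gives an identity between
    nonnegative functions, and positive definiteness compares what remains. *)
Lemma expectation_one_sub_cos_le (X Y : T -> R) (s : R) :
  measurable_fun setT X -> measurable_fun setT Y -> positive_definite_law P X Y ->
  \int[P]_w (1 - cos (s * (X w - Y w)))%:E <=
  \int[P]_w (1 - cos (s * (X w + Y w)))%:E.
Proof.
move=> mX mY PD.
pose p (x : R) := (Num.max (sin (s * x)) 0)%R.
pose q (x : R) := (Num.max (- sin (s * x)) 0)%R.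
have msin : measurable_fun [set: R] (fun x => sin (s * x)).
  by apply: measurableT_comp (@measurable_sin R) _; exact: measurable_funM.
have mp : measurable_fun setT p by exact: measurable_maxr.
have mq : measurable_fun setT q.
  by apply: measurable_maxr => //; exact: measurableT_comp.
have p0 x : (0 <= p x)%R by rewrite /p le_max lexx orbT.
have q0 x : (0 <= q x)%R by rewrite /q le_max lexx orbT.
have le1 (f : R) : (`|f| <= 1 -> Num.max f 0 <= 1)%R.
  by rewrite ge_max ler01 andbT; exact: le_trans (ler_norm _).
have p1 x : (p x <= 1)%R by apply: le1; exact: sin_max.
have q1 x : (q x <= 1)%R by apply: le1; rewrite normrN; exact: sin_max.
have pqE x : (p x - q x = sin (s * x))%R.
  rewrite /p /q; have [h|/ltW h] := leP (sin (s * x)) 0%R.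
    by rewrite max_l ?oppr_ge0// sub0r opprK.
  by rewrite max_r ?oppr_le0// subr0.
pose B w := (p (X w) * q (Y w) + q (X w) * p (Y w))%R.
pose A w := (p (X w) * p (Y w) + q (X w) * q (Y w))%R.
have mm (f g : R -> R) : measurable_fun setT f -> measurable_fun setT g ->
    measurable_fun setT (fun w => (f (X w) * g (Y w))%R).
  by move=> mf mg; apply: measurable_funM; exact: measurableT_comp.
have mA : measurable_fun setT A by apply: measurable_funD; exact: mm.
have mB : measurable_fun setT B by apply: measurable_funD; exact: mm.
have A0 w : (0 <= A w)%R by rewrite addr_ge0 ?mulr_ge0.
have B0 w : (0 <= B w)%R by rewrite addr_ge0 ?mulr_ge0.
have BA : \int[P]_w (B w)%:E <= \int[P]_w (A w)%:E.
  have add (f g f' g' : R -> R) :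
      [/\ measurable_fun setT f, measurable_fun setT g,
        measurable_fun setT f' & measurable_fun setT g'] ->
      [/\ forall x, (0 <= f x)%R, forall x, (0 <= g x)%R,
        forall x, (0 <= f' x)%R & forall x, (0 <= g' x)%R] ->
      \int[P]_w (f (X w) * g (Y w) + f' (X w) * g' (Y w))%:E =
      \int[P]_w (f (X w) * g (Y w))%:E + \int[P]_w (f' (X w) * g' (Y w))%:E.
    move=> [mf mg mf' mg'] [f0 g0 f0' g0'].
    under eq_integral do rewrite EFinD.
    rewrite ge0_integralD//; do ?[by apply/measurable_EFinP; exact: mm |
      by move=> w _; rewrite lee_fin mulr_ge0].
  by rewrite /A /B !add//; exact: PD.
(* p and q are at most 1, so the terms to be cancelled below are finite *)
have Afin : \int[P]_w (A w)%:E \is a fin_num.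
  rewrite ge0_fin_numE ?integral_ge0// => [|w _]; last by rewrite lee_fin.
  apply: (@le_lt_trans _ _ (\int[P]_w (cst 2%:E w))).
    apply: ge0_le_integral => //.
    - by move=> w _; rewrite lee_fin.
    - exact/measurable_EFinP.
    - move=> w _; rewrite lee_fin /A.
      have := mulr_ile1 (p0 (X w)) (p0 (Y w)) (p1 _) (p1 _).
      have := mulr_ile1 (q0 (X w)) (q0 (Y w)) (q1 _) (q1 _).
      lra.
  rewrite integral_cst// (_ : _ setT = 1) ?mule1 ?ltry//; exact: probability_setT.
pose U w := (1 - cos (s * (X w - Y w)))%R.
pose V w := (1 - cos (s * (X w + Y w)))%R.
have mU : measurable_fun setT U.
  by apply: measurable_one_sub_cos; apply: measurable_funM => //; exact: measurable_funB.
have mV : measurable_fun setT V.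
  by apply: measurable_one_sub_cos; apply: measurable_funM => //; exact: measurable_funD.
have UV : \int[P]_w (U w)%:E + (\int[P]_w (A w)%:E + \int[P]_w (A w)%:E) =
          \int[P]_w (V w)%:E + (\int[P]_w (B w)%:E + \int[P]_w (B w)%:E).
  have dbl (F G : T -> R) : measurable_fun setT F -> measurable_fun setT G ->
      (forall w, (0 <= F w)%R) -> (forall w, (0 <= G w)%R) ->
      \int[P]_w (F w)%:E + (\int[P]_w (G w)%:E + \int[P]_w (G w)%:E) =
      \int[P]_w (F w + (G w + G w))%:E.
    move=> mF mG F0 G0.
    under [RHS]eq_integral do rewrite EFinD EFinD.
    rewrite ge0_integralD//; first rewrite ge0_integralD//.
    - by move=> w _; rewrite lee_fin.
    - exact/measurable_EFinP.
    - by move=> w _; rewrite lee_fin.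
    - exact/measurable_EFinP.
    - by move=> w _; rewrite lee_fin.
    - exact/measurable_EFinP.
    - by move=> w _; rewrite -EFinD lee_fin addr_ge0.
    - by apply: emeasurable_funD; exact/measurable_EFinP.
  rewrite !dbl//; do ?[by move=> w; exact: one_sub_cos_ge0].
  apply: eq_integral => w _; congr EFin.
  rewrite /U /V mulrBr mulrDr cosB cosD -!pqE /A /B; ring.
have : \int[P]_w (U w)%:E + (\int[P]_w (A w)%:E + \int[P]_w (A w)%:E) <=
       \int[P]_w (V w)%:E + (\int[P]_w (A w)%:E + \int[P]_w (A w)%:E).
  by rewrite UV leeD2l// leeD.
by rewrite leeD2rE// fin_numD Afin.
Qed.

Lemma measurable_cos_weight (Z : T -> R) (r : R) : measurable_fun setT Z ->
  measurable_fun [set: T * measurableTypeR R]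
    (fun z => ((1 - cos (expR z.2 * Z z.1)) * expR (- (r * z.2)))%:E).
Proof.
move=> mZ; apply/measurable_EFinP/measurable_funM.
  apply: measurable_funB => //.
  apply: (measurableT_comp (@measurable_cos R)); apply: measurable_funM.
    exact: measurableT_comp.
  exact: measurableT_comp.
apply: measurableT_comp => //; apply: measurableT_comp => //.
by apply: measurable_funM => //; exact: measurable_snd.
Qed.

Lemma moment_integral_cos (Z : T -> R) (r : R) : (0 < r)%R ->
  measurable_fun setT Z ->
  (\int[P]_w (`|Z w| `^ r)%:E) * levy_const r =
  \int[mu]_v \int[P]_w ((1 - cos (expR v * Z w)) * expR (- (r * v)))%:E.
Proof.
move=> r0 mZ.
have C0 : 0 <= levy_const r by rewrite ltW// levy_const_gt0.
rewrite -ge0_integralZr//; last first.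
  apply/measurable_EFinP; apply: (measurableT_comp (measurable_powR r)).
  exact: measurableT_comp.
under eq_integral do rewrite -absr_powR_cos_integral//.
rewrite (fubini_tonelli (fun z : T * measurableTypeR R =>
  ((1 - cos (expR z.2 * Z z.1)) * expR (- (r * z.2)))%:E))//=.
  exact: measurable_cos_weight.
Qed.

(** Multiplied by the constant of the mixture, which is finite and positive, both
    moments are integrals over v of the quantities at frequency exp v, where the
    inequality is known. *)
Lemma positive_definite_law_moment_le (X Y : T -> R) (r : R) :
  (0 < r)%R -> (r < 2)%R ->
  measurable_fun setT X -> measurable_fun setT Y -> positive_definite_law P X Y ->
  \int[P]_w (`|X w - Y w| `^ r)%:E <= \int[P]_w (`|X w + Y w| `^ r)%:E.
Proof.
move=> r0 r2 mX mY PD.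
have Cfin : levy_const r \is a fin_num.
  by rewrite ge0_fin_numE ?levy_const_lty// ltW// levy_const_gt0.
rewrite -(lee_pmul2r Cfin (levy_const_gt0 r0)).
rewrite !moment_integral_cos//; last 2 first.
  exact: measurable_funD.
  exact: measurable_funB.
have mcos (Z : T -> R) v : measurable_fun setT Z ->
    measurable_fun setT (fun w => (1 - cos (expR v * Z w))%:E).
  move=> mZ; apply/measurable_EFinP/measurable_one_sub_cos.
  exact: measurable_funM.
have split_weight (Z : T -> R) v : measurable_fun setT Z ->
    \int[P]_w ((1 - cos (expR v * Z w)) * expR (- (r * v)))%:E =
    (expR (- (r * v)))%:E * \int[P]_w (1 - cos (expR v * Z w))%:E.
  move=> mZ; rewrite -ge0_integralZl_EFin ?expR_ge0//.
  - by apply: eq_integral => w _; rewrite -EFinM mulrC.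
  - exact: mcos.
have mG (Z : T -> R) : measurable_fun setT Z ->
    measurable_fun [set: measurableTypeR R]
      (fun v => \int[P]_w ((1 - cos (expR v * Z w)) * expR (- (r * v)))%:E).
  move=> mZ; apply: (measurable_fun_fubini_tonelli_G (fun z : T * measurableTypeR R =>
    ((1 - cos (expR z.2 * Z z.1)) * expR (- (r * z.2)))%:E)).
    exact: measurable_cos_weight.
  by move=> z; rewrite lee_fin mulr_ge0 ?one_sub_cos_ge0 ?expR_ge0.
have mB : measurable_fun setT (fun w => (X w - Y w)%R) by exact: measurable_funB.
have mD : measurable_fun setT (fun w => (X w + Y w)%R) by exact: measurable_funD.
apply: ge0_le_integral => //.
- move=> v _; apply: integral_ge0 => w _.
  by rewrite lee_fin mulr_ge0 ?one_sub_cos_ge0 ?expR_ge0.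
- exact: mG.
- exact: mG.
- move=> v _; rewrite !split_weight//.
  by apply: lee_wpmul2l; [rewrite lee_fin expR_ge0|exact: expectation_one_sub_cos_le].
Qed.
End Moments.

(** * Discrete and continuous laws are positive definite *)

Import HBNNSimple.

(** If Z has density g with respect to m, then expectations of functions of Z
    are integrals against g: both sides agree on simple functions and pass to
    increasing limits. *)
Lemma ge0_integral_density dT dS (T : measurableType dT) (S : measurableType dS)
    (R : realType) (P : probability T R) (Z : {RV P >-> S})
    (m : {measure set S -> \bar R}) (g : S -> R) (f : S -> \bar R) :
  measurable_fun setT g -> (forall z, (0 <= g z)%R) ->
  (forall A, measurable A -> P (Z @^-1` A) = \int[m]_(z in A) (g z)%:E) ->
  measurable_fun setT f -> (forall z, 0 <= f z) ->
  \int[P]_w f (Z w) = \int[m]_z (f z * (g z)%:E).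
Proof.
move=> /measurable_EFinP mg g0 PZ mf f0.
pose h := nnsfun_approx measurableT mf.
have hf z : EFin \o h ^~ z @ \oo --> f z by exact: cvg_nnsfun_approx.
have simple n : \int[distribution P Z]_z (h n z)%:E = \int[m]_z ((h n z)%:E * (g z)%:E).
  have mh r : measurable (h n @^-1` [set r]) by [].
  pose u r := (EFin \o g) \_ (h n @^-1` [set r]).
  have u0 r z : 0 <= u r z by apply: erestrict_ge0 => y _; rewrite lee_fin.
  have mu r : measurable_fun setT (u r).
    by apply/(measurable_restrictT _ (mh r)); exact: measurable_funTS.
  rewrite integralT_nnsfun sintegralE.
  transitivity (\int[m]_z (\sum_(r \in range (h n)) (r%:E * u r z))).
    rewrite ge0_integral_fsum//.
    - apply: eq_fsbigr => r /set_mem[z _ <-].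
      by rewrite ge0_integralZl_EFin// -integral_mkcond -PZ.
    - by move=> r; exact: measurable_funeM.
    - move=> r z _; have [r0|r0] := leP 0%R r; first by rewrite mule_ge0 ?lee_fin.
      by rewrite /u preimage_nnfun0// patchE memNset ?mule0.
  apply: eq_integral => z _.
  rewrite (fsbigD1 (h n z))//=; last by exists z.
  rewrite /u patchE mem_set// fsbig1 ?adde0// => r [_ rz].
  by rewrite patchE memNset ?mule0// => /esym.
rewrite -(ge0_integral_distribution Z mf f0).
transitivity (limn (fun n => \int[distribution P Z]_z (h n z)%:E)).
  rewrite -monotone_convergence//.
  - by apply: eq_integral => z _; apply/esym/cvg_lim => //; exact: hf.
  - by move=> n; apply/measurable_EFinP.
  - by move=> n z _; rewrite lee_fin.
  - by move=> z _ a b ab; rewrite lee_fin; exact/lefP/nd_nnsfun_approx.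
under eq_fun do rewrite simple.
rewrite -monotone_convergence//.
- by apply: eq_integral => z _; apply/cvg_lim => //; apply: cvgeZr => //; exact: hf.
- by move=> n; apply: emeasurable_funM => //; apply/measurable_EFinP.
- by move=> n z _; rewrite mule_ge0// lee_fin.
- move=> z _ a b ab; apply: lee_wpmul2r; first by rewrite lee_fin.
  by rewrite lee_fin; exact/lefP/nd_nnsfun_approx.
Qed.

Lemma integral_product_density dT dS (T : measurableType dT) (S : measurableType dS)
    (R : realType) (P : probability T R) (X Y : T -> S)
    (m : {sigma_finite_measure set S -> \bar R}) (D : set S) (k : S * S -> R)
    (p q : S -> R) :
  measurable_fun setT X -> measurable_fun setT Y -> measurable D ->
  measurable_fun (D `*` D) k -> (forall x y, D x -> D y -> (0 <= k (x, y))%R) ->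
  (forall B : set (S * S), measurable B ->
    P [set w | B (X w, Y w)] = \int[m \x m]_(z in B `&` (D `*` D)) (k z)%:E) ->
  measurable_fun setT p -> measurable_fun setT q ->
  (forall x, (0 <= p x)%R) -> (forall x, (0 <= q x)%R) ->
  \int[P]_w (p (X w) * q (Y w))%:E =
  \int[m]_(x in D) \int[m]_(y in D) (p x * q y * k (x, y))%:E.
Proof.
move=> mX mY mD mk k0 PXY mp mq p0 q0.
have mDD : measurable (D `*` D) by exact: measurableX.
pose g := (k \_ (D `*` D))%R.
have g0 z : (0 <= g z)%R.
  rewrite /g patchE; case: ifPn => // /set_mem[]; case: z => x y /= Dx Dy.
  exact: k0.
have mg : measurable_fun [set: S * S] g.
  exact/(measurable_restrictT _ mDD).
have mXY : measurable_fun setT (fun w => (X w, Y w)).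
  exact: measurable_fun_pair.
pose Z : {RV P >-> (S * S)%type} := HB.pack (fun w => (X w, Y w))
  (isMeasurableFun.Build _ _ _ _ _ mXY).
have PZ (A : set (S * S)) : measurable A ->
    P (Z @^-1` A) = \int[m \x m]_(z in A) (g z)%:E.
  move=> mA; rewrite [LHS](PXY A mA) integral_mkcondr.
  by apply: eq_integral => z _; rewrite restrict_EFin.
pose f (z : S * S) := (p z.1 * q z.2)%:E.
have mf : measurable_fun [set: S * S] f.
  by apply/measurable_EFinP/measurable_funM; exact: measurableT_comp.
have f0 z : 0 <= f z by rewrite lee_fin mulr_ge0.
have := @ge0_integral_density _ _ T (S * S)%type R P Z (m \x m)%E g f mg g0 PZ mf f0.
rewrite /f/= => ->.
rewrite (fubini_tonelli1 (fun z => f z * (g z)%:E)); last 2 first.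
  by apply: emeasurable_funM => //; exact/measurable_EFinP.
  by move=> z; rewrite mule_ge0// lee_fin.
rewrite [RHS]integral_mkcond; apply: eq_integral => x _; rewrite patchE.
case: ifPn => xD; last first.
  rewrite /fubini_F integral0_eq// => y _; rewrite /g patchE ifF ?mule0//.
  by apply/negbTE; apply: contra xD => /set_mem[? _]; exact/mem_set.
rewrite [RHS]integral_mkcond; apply: eq_integral => y _; rewrite /g !patchE in_setX/= xD/=.
by case: ifP => _; rewrite /f -EFinM ?mulr0.
Qed.

Lemma mass_kernel_ge0 (R : realType) (U : Type) (c d : U -> R) x y :
  (0 < c x)%R /\ (0 < d x)%R -> (0 < c y)%R /\ (0 < d y)%R ->
  (0 <= mass_kernel c d x y)%R.
Proof.
by move=> [c1 d1] [c2 d2]; rewrite divr_ge0 ?mulr_ge0 ?addr_ge0 ?ltW.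
Qed.

Lemma continuous_law_positive_definite dT (T : measurableType dT) (R : realType)
    (P : probability T R) (X Y : {RV P >-> R}) :
  continuous_law X Y -> positive_definite_law P X Y.
Proof.
move=> [D [c [d [mD [mc md] cd0 _ PXY]]]].
apply: (@positive_definite_law_cauchy _ _ _ _ _ _ _ (measurableTypeR R)
  lebesgue_measure D id c d) => //.
move=> p q mp mq p0 q0.
have mDD : measurable (D `*` D : set (measurableTypeR R * measurableTypeR R)).
  exact: measurableX.
have fst_comp (f : R -> R) : measurable_fun D f ->
    measurable_fun (D `*` D) (fun z : measurableTypeR R * measurableTypeR R => f z.1).
  move=> mf; apply: (measurable_comp mD) mf _ => [_ [[x y] [Dx _] <-]//|].
  by apply: measurable_funTS; exact: measurable_fst.
have snd_comp (f : R -> R) : measurable_fun D f ->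
    measurable_fun (D `*` D) (fun z : measurableTypeR R * measurableTypeR R => f z.2).
  move=> mf; apply: (measurable_comp mD) mf _ => [_ [[x y] [_ Dy] <-]//|].
  by apply: measurable_funTS; exact: measurable_snd.
apply: (@integral_product_density _ _ T (measurableTypeR R) R P X Y lebesgue_measure
  D (fun z => mass_kernel c d z.1 z.2)) => //.
- exact: (measurable_funP X).
- exact: (measurable_funP Y).
- apply: measurable_funM.
    by apply: measurable_funM; [exact: fst_comp|exact: snd_comp].
  (* the inverse is a real power, since c is positive on D *)
  apply: (@eq_measurable_fun _ _ _ _ _ (fun z => (c z.1 + c z.2) `^ (-1))%R).
    move=> z /set_mem[/cd0[c1 _] /cd0[c2 _]].
    by rewrite powR_inv1// addr_ge0 ?ltW.
  apply: (measurableT_comp (measurable_powR _)).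
  by apply: measurable_funD; [exact: fst_comp|exact: snd_comp].
- by move=> x y /cd0 cdx /cd0 cdy; exact: mass_kernel_ge0.
Qed.

(* counting measure on nat as a sigma-finite measure, as Tonelli requires *)
HB.instance Definition _ (R : realType) :=
  Measure_isSigmaFinite.Build _ nat R (@counting nat R) (sigma_finite_counting R).

(** The events X = a_i, Y = a_j are disjoint because the a_i are distinct, and
    their probabilities add up to 1; so every expectation splits into a double
    sum over them, which is a double integral for counting measure. *)
Lemma discrete_law_positive_definite dT (T : measurableType dT) (R : realType)
    (P : probability T R) (X Y : {RV P >-> R}) :
  discrete_law X Y -> positive_definite_law P X Y.
Proof.
move=> [I [a [c [d [_ inj_a cd0 mass1 PXY]]]]].
pose m : {sigma_finite_measure set nat -> \bar R} := @counting nat R.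
apply: (@positive_definite_law_cauchy _ _ _ _ _ _ _ _ m I a c d) => //.
move=> p q mp mq p0 q0.
(* membership in I is part of E i j, which is thus empty off the index set *)
pose E i j := [set w | [/\ I i, I j, X w = a i & Y w = a j]].
pose F i := \bigcup_j E i j.
pose Omega := \bigcup_i F i.
have mE i j : measurable (E i j).
  have [[Ii Ij]|nI] := pselect (I i /\ I j).
    rewrite (_ : E i j = (X @^-1` [set a i]) `&` (Y @^-1` [set a j])); last first.
      by apply/seteqP; split => w; [case|move=> []].
    by apply: measurableI; rewrite -[_ @^-1` _]setTI; exact: measurable_funP.
  by rewrite (_ : E i j = set0)//; apply/seteqP; split => w //= -[Ii Ij _ _]; case: nI.
have mF i : measurable (F i) by exact: bigcupT_measurable.
have mOmega : measurable Omega by exact: bigcupT_measurable.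
have tF : trivIset setT F.
  move=> i i' _ _ [w [[j _ [Ii _ Xi _]] [j' _ [Ii' _ Xi' _]]]].
  by apply: inj_a; rewrite ?inE// -Xi -Xi'.
have tE i : trivIset setT (E i).
  move=> j j' _ _ [w [[_ Ij _ Yj] [_ Ij' _ Yj']]].
  by apply: inj_a; rewrite ?inE// -Yj -Yj'.
have split_Omega (f : T -> \bar R) : measurable_fun setT f -> (forall w, 0 <= f w) ->
    \int[P]_(w in Omega) f w =
    \sum_(0 <= i <oo) \sum_(0 <= j <oo) \int[P]_(w in E i j) f w.
  move=> mf f0; rewrite ge0_integral_bigcup//; last exact: measurable_funTS.
  apply: eq_eseriesr => i _; rewrite ge0_integral_bigcup//; exact: measurable_funTS.
pose k i j := if (i \in I) && (j \in I) then (mass_kernel c d i j)%:E else 0.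
have k0 i j : 0 <= k i j.
  rewrite /k; case: ifPn => // /andP[/set_mem/cd0 cdi /set_mem/cd0 cdj].
  by rewrite lee_fin mass_kernel_ge0.
have PE i j : P (E i j) = k i j.
  rewrite /k; case: ifPn => [/andP[/set_mem Ii /set_mem Ij]|nI].
    rewrite -PXY//; congr (P _); apply/seteqP; split => w /=; first by case.
    by case.
  rewrite (_ : E i j = set0) ?measure0//; apply/seteqP; split => w //= [Ii Ij _ _].
  by move: nI; rewrite !mem_set.
have int_cst i j (r : \bar R) : \int[P]_(w in E i j) cst r w = r * k i j.
  by rewrite -PE; exact: integral_cst.
(* the same splitting, applied to the function 1, shows that Omega has full mass *)
have POmega : P Omega = 1.
  rewrite -[LHS]mul1e -integral_cst// split_Omega//.
  rewrite -[RHS]mass1.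
  under eq_eseriesr => i _ do under eq_eseriesr => j _ do
    rewrite int_cst mul1e.
  rewrite nneseries_esumT; last by move=> i; exact: nneseries_ge0.
  rewrite [RHS]esum_mkcond; apply: eq_esum => i _; rewrite nneseries_esumT//.
  rewrite /k; case: ifPn => Ii; last by rewrite esum1.
  by rewrite [RHS]esum_mkcond.
pose f w := (p (X w) * q (Y w))%:E.
have mf : measurable_fun setT f.
  by apply/measurable_EFinP/measurable_funM; exact: measurableT_comp.
have f0 (w : T) : 0 <= f w by rewrite lee_fin mulr_ge0.
transitivity (\int[P]_(w in Omega) f w).
  rewrite (@ge0_negligible_integral _ _ _ P setT (~` Omega) f)//.
  - by rewrite setTD setCK.
  - exact: measurableC.
  - by transitivity (1 - P Omega); [exact: probability_setC|rewrite POmega subee].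
rewrite split_Omega// [RHS]integral_mkcond ge0_integral_count; last first.
  move=> i; apply: erestrict_ge0 => {}i Ii; apply: integral_ge0 => j Ij.
  by rewrite lee_fin mulr_ge0//; [exact: mulr_ge0|apply: mass_kernel_ge0; exact: cd0].
apply: eq_eseriesr => i _.
have fE j : \int[P]_(w in E i j) f w = (p (a i) * q (a j))%:E * k i j.
  rewrite -int_cst; apply: eq_integral => w /set_mem[_ _ Xi Yj].
  by rewrite /f Xi Yj.
under eq_eseriesr => j _ do rewrite fE.
rewrite patchE; case: ifPn => Ii; last first.
  by rewrite eseries0// => j _ _; rewrite /k (negbTE Ii) mule0.
rewrite integral_mkcond ge0_integral_count.
  apply: eq_eseriesr => j _; rewrite patchE /k Ii/=; case: ifP => _; last by rewrite mule0.
  by rewrite -EFinM.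
move=> j; apply: erestrict_ge0 => {}j Ij.
rewrite lee_fin mulr_ge0//; first exact: mulr_ge0.
by apply: mass_kernel_ge0; [exact/cd0/set_mem|exact: cd0].
Qed.

Theorem corollary4 (R : realType) (dT : measure_display)
    (T : measurableType dT) (P : probability T R) (X Y : {RV P >-> R}) (r : R)
    (r_gt0 : (0 < r)%R) (r_lt2 : (r < 2)%R)
    (X_moment : 'E_P[fun w => (`|X w| `^ r)%R] < +oo)
    (XY_law : discrete_law X Y \/ continuous_law X Y) :
  'E_P[fun w => (`|X w + Y w| `^ r)%R] >= 'E_P[fun w => (`|X w - Y w| `^ r)%R].
Proof.
rewrite unlock; apply: positive_definite_law_moment_le => //.
by case: XY_law => [/discrete_law_positive_definite|/continuous_law_positive_definite].
Qed.
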